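(* There exist continuum many non-homeomorphic L-Cantorvals; that is, there is a family of cardinality $2^{\aleph_0}$ consisting of pairwise non-homeomorphic L-Cantorvals.
   Context: For a compact set $X\subseteq\mathbb{R}$, an $X$-gap is a component of $\mathbb{R}\setminus X$ (the two unbounded components are included), and an $X$-interval is a non-trivial (more than one point) component of $X$. A set $X\subseteq\mathbb{R}$ is an L-Cantorval if it is nonempty, compact, and any $X$-gap has an $X$-interval adjacent to its right and is accumulated on the left by infinitely many $X$-intervals and $X$-gaps. Explicitly: if an $X$-gap has a finite right endpoint $b$, then $b$ is the left endpoint of an $X$-interval (in particular $\min X$ is the left endpoint of an $X$-interval); if an $X$-gap has a finite left endpoint $a$, then for every $\varepsilon>0$ the set $(a-\varepsilon,a)$ contains infinitely many $X$-gaps and infinitely many $X$-intervals (in particular this holds for $a=\max X$). L-Cantorvals carry the subspace topology from $\mathbb{R}$. *)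

(* Defs.v *)
From HB Require Import structures.
From mathcomp Require Import all_boot all_order all_algebra.
From mathcomp Require Import all_classical all_reals all_analysis.

Set Implicit Arguments.
Unset Strict Implicit.
Unset Printing Implicit Defensive.

Import Order.TTheory GRing.Theory Num.Theory.
Import numFieldTopology.Exports numFieldNormedType.Exports.

Local Open Scope classical_set_scope.
Local Open Scope ring_scope.

Definition homeomorphic (T U : topologicalType) : Prop :=
  exists (f : T -> U) (g : U -> T),
    [/\ continuous f, continuous g, cancel f g & cancel g f].

Section LCantorval.
Variable R : realType.
Implicit Types X G I : set R.

Definition component (A C : set R) : Prop := (connected_component A @` A) C.

Definition gap X G : Prop := component (~` X) G.

Definition nontrivial_component X I : Prop :=
  component X I /\ exists x y, [/\ I x, I y & x != y].

(* Components in R are order-convex and nonempty, so a finite right (left)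
   endpoint is the same thing as a real supremum (infimum). *)
Definition right_endpoint (A : set R) (b : R) : Prop := supremums A b.
Definition left_endpoint (A : set R) (a : R) : Prop := infimums A a.

Definition is_LCantorval X : Prop :=
  [/\ X !=set0,
      compact X,
      (forall G b, gap X G -> right_endpoint G b ->
         exists I, nontrivial_component X I /\ left_endpoint I b)
    & (forall G a, gap X G -> left_endpoint G a ->
         forall e : R, 0 < e ->
           infinite_set [set H | gap X H /\ H `<=` `]a - e, a[] /\
           infinite_set
             [set I | nontrivial_component X I /\ I `<=` `]a - e, a[])].

End LCantorval.

(* Main.v *)
(** Label the finite words over [nat] by disjoint closed intervals ("plateaus")
  whose union is dense in [0, 1], the plateaus of the words [u ++ i :: w]
  shrinking to the right end of the plateau of [u] as [i] grows.  Deleting the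
  left half of a plateau creates a gap followed by an interval; keeping it
  whole creates an interval accumulated by gaps from both sides.  As long as
  the non-whole plateaus stay dense, the remaining set is an L-Cantorval.

  The whole plateaus are recognised topologically: their two end points both
  lie on the boundary of a single component.  Keep the plateau of [m :: w]
  whole when [size w <= m.+1], except that of [[:: m]] when [m] belongs to a
  prescribed set [A].  Whole plateaus then accumulate only from the right, and
  iterating [limit_point] on their end points removes one level of words at a
  time, so that the right end of [[:: m]] has Cantor-Bendixson rank exactly
  [m.+1].  It belongs to a whole plateau iff [m] is not in [A], and hence the
  homeomorphism type of the set determines [A]. *)

Require Import Defs.
From HB Require Import structures.
From mathcomp Require Import all_boot all_order all_algebra.
From mathcomp Require Import all_classical all_reals all_analysis.
From mathcomp Require Import ring lra zify.
Import Order.TTheory GRing.Theory Num.Theory.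
Import numFieldTopology.Exports numFieldNormedType.Exports.

Local Open Scope classical_set_scope.
Local Open Scope card_scope.
Local Open Scope ring_scope.

Set Implicit Arguments.
Unset Strict Implicit.
Unset Printing Implicit Defensive.

(** * Plateaus *)

Section Plateaus.
Context {R : realType}.
Implicit Types (u v w : seq nat) (i j k m n : nat) (x y p q : R).

Definition cell_scale i : R := 2^-1 ^+ i.+2.

(* The maps [cell i] send [0, 1] onto consecutive intervals that fill ]1/2, 1]
   from right to left and accumulate at 1/2. *)
Definition cell i x : R := 2^-1 + cell_scale i * (1 + x).

(** The plateau of [u] is the image of [[0, 1/2]], the plateau of the empty word, under the composed
    maps [cell i] for the letters [i] of [u]. *)
Definition lft u : R := foldr cell 0 u.
Definition rgt u : R := foldr cell 2^-1 u.

Lemma cell_scale_gt0 i : 0 < cell_scale i.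
Proof. by rewrite exprn_gt0// invr_gt0. Qed.

Lemma cell_scaleS i : cell_scale i.+1 = cell_scale i / 2.
Proof. by rewrite /cell_scale exprSr. Qed.

Lemma cell_scale_le4 i : cell_scale i <= 4^-1.
Proof.
elim: i => [|i IH]; first by rewrite /cell_scale !exprS expr0; lra.
by rewrite cell_scaleS; have := cell_scale_gt0 i; lra.
Qed.

Lemma cell_scale_le i j : (i <= j)%N -> cell_scale j <= cell_scale i.
Proof. by move=> ij; rewrite /cell_scale ler_wiXn2l//; lra. Qed.

Lemma cellK i x : cell i ((x - 2^-1) / cell_scale i - 1) = x.
Proof. by rewrite /cell; field; rewrite gt_eqF ?cell_scale_gt0. Qed.

Lemma cell_le i : {mono cell i : x y / x <= y}.
Proof. by move=> x y; rewrite lerD2l ler_pM2l ?cell_scale_gt0// lerD2l. Qed.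

Lemma cell_lt i : {mono cell i : x y / x < y}.
Proof. exact: leW_mono (cell_le i). Qed.

Lemma cell_gt_half i x : 0 <= x -> 2^-1 < cell i x.
Proof. by move=> x0; rewrite ltrDl mulr_gt0 ?cell_scale_gt0//; lra. Qed.

Lemma cell_le1 i x : x <= 1 -> cell i x <= 1.
Proof.
move=> x1; have := cell_scale_le4 i; have := cell_scale_gt0 i.
rewrite /cell => ? ?.
have : cell_scale i * (1 + x) <= cell_scale i * 2 by rewrite ler_pM2l//; lra.
lra.
Qed.

Lemma cell_consecutive i j : (i < j)%N -> cell j 1 <= cell i 0.
Proof.
by move=> ij; have := cell_scale_le ij; rewrite cell_scaleS /cell; lra.
Qed.

Lemma lft_ge0 u : 0 <= lft u.
Proof.
elim: u => //= i u /(cell_gt_half i) H; apply/ltW/(lt_trans _ H).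
by rewrite invr_gt0.
Qed.

Lemma lft_rgt u : lft u < rgt u.
Proof. by elim: u => [|i u IH] /=; [rewrite invr_gt0 | rewrite cell_lt]. Qed.

Lemma rgt_lt1 u : rgt u < 1.
Proof.
elim: u => [|i u IH] /=; first by rewrite /rgt/=; lra.
by apply: lt_le_trans (cell_le1 i (lexx 1)); rewrite cell_lt.
Qed.

Lemma half_lt_lft i u : 2^-1 < lft (i :: u).
Proof. exact/cell_gt_half/lft_ge0. Qed.

Lemma rgt_cat_lft u i w : rgt u < lft (u ++ i :: w).
Proof.
by elim: u => [|j u IH] /=; rewrite ?cell_lt//; exact: half_lt_lft.
Qed.

(** Once the common prefix is stripped, either one word is empty, and the other plateau lies right
    of 1/2, or the first letters differ and the cells are ordered; [rgt_lt1] gives strictness. *)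
Lemma plateau_disjoint u v : u != v -> rgt u < lft v \/ rgt v < lft u.
Proof.
elim: u v => [|i u IH] [|j v] //=.
- by left; exact: half_lt_lft.
- by right; exact: half_lt_lft.
rewrite eqseq_cons negb_and; have [->/= /IH|ij _] := eqVneq i j.
  by rewrite /= !cell_lt.
have lt k l s t : (k < l)%N -> rgt (l :: s) < lft (k :: t).
  move=> /cell_consecutive kl; apply: lt_le_trans (_ : cell l 1 <= _).
    by rewrite /= cell_lt rgt_lt1.
  by apply: le_trans kl _; rewrite /= cell_le lft_ge0.
by case: (ltngtP i j) ij => // ij _; [right|left]; exact: lt.
Qed.

Lemma plateau_meet u v x :
  lft u <= x <= rgt u -> lft v <= x <= rgt v -> u = v.
Proof.
move=> /andP[ux xu] /andP[vx xv]; apply/eqP; apply: contrapT => /negP.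
by case/plateau_disjoint; lra.
Qed.

(** * Density and accumulation of plateaus *)

Lemma half_expn_small e : 0 < e -> exists n, 2^-1 ^+ n < e :> R.
Proof.
move=> e0; have := @cvg_expr R 2^-1; rewrite ger0_norm ?invr_ge0//.
move=> /(_ ltac:(lra)) /cvgrPdist_lt /(_ e e0)[N _ /(_ N)] /=.
rewrite sub0r normrN ger0_norm ?exprn_ge0 ?invr_ge0//.
by exists N; auto.
Qed.

Lemma cell_close x y : 0 <= x -> 2^-1 < y ->
  exists N, forall i, (N <= i)%N -> cell i x < y.
Proof.
move=> x0 y2; have [|N HN] := half_expn_small (e := (y - 2^-1) / (1 + x)).
  by rewrite divr_gt0//; lra.
exists N => i Ni; rewrite /cell -ltrBrDl -ltr_pdivlMr; last lra.
apply: le_lt_trans HN; rewrite /cell_scale ler_wiXn2l//; first lra.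
by lia.
Qed.

(** Induction on [n] with [2^-n < q - p]: unless a plateau is found at once, both points lie in one
    cell, and undoing its map magnifies their distance at least fourfold. *)
Lemma plateau_dense p q : 0 <= p -> p < q -> q <= 1 ->
  exists u, lft u < q /\ p < rgt u.
Proof.
move=> + pq; have [|n] := half_expn_small (e := q - p); first lra.
elim: n p q pq => [|n IH] p q pq.
  by move=> + ? ?; lra.
move=> qpn p0 q1.
have [p2|p2] := ltP p 2^-1; first by exists [::]; split; rewrite /lft/=; lra.
have : exists i, cell i 0 < q.
  by have [//||N /(_ N (leqnn N))] := @cell_close 0 q; [lra|exists N].
move=> /[dup] -[i0 _] /(@ex_minnP (fun i => cell i 0 < q)) [i iq mini].
have qi : q <= cell i 1.
  case: i iq mini => [|i] iq mini; first by rewrite /cell /cell_scale; lra.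
  have /(le_trans _)-> // : cell i 0 <= cell i.+1 1.
    by rewrite /cell cell_scaleS; lra.
  by rewrite leNgt; apply/negP => /mini; rewrite ltnn.
have [pi|pi] := ltP p (rgt [:: i]); first by exists [:: i].
pose r x := (x - 2^-1) / cell_scale i - 1.
have rK x : cell i (r x) = x by exact: cellK.
have [||||u [uq pu]] := IH (r p) (r q).
- by rewrite -(cell_lt i) !rK.
- have : q - p <= 4^-1 * (r q - r p).
    rewrite -{1}(rK q) -{1}(rK p) /cell.
    have -> : 2^-1 + cell_scale i * (1 + r q) -
      (2^-1 + cell_scale i * (1 + r p)) = cell_scale i * (r q - r p) by ring.
    by rewrite ler_pM2r ?cell_scale_le4// subr_gt0 -(cell_lt i) !rK.
  have : (0:R) <= 2^-1 ^+ n by rewrite exprn_ge0 ?invr_ge0.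
  by move: qpn; rewrite exprS; lra.
- rewrite -(cell_le i) rK; apply: le_trans pi.
  by rewrite /= cell_le; lra.
- by rewrite -(cell_le i) rK.
by exists (i :: u); rewrite /= -(rK p) -[in X in _ < X /\ _](rK q) !cell_lt.
Qed.

(** At the root the cells shrink to 1/2, whatever the tail [w]; the increasing bijections [cell j]
    carry this to every word. *)
Lemma subtree_close u y : rgt u < y ->
  exists N, forall i w, (N <= i)%N -> rgt (u ++ i :: w) < y.
Proof.
elim: u y => [|j u IH] y /=.
  move=> /(cell_close ler01)[N HN]; exists N => i w /HN.
  by apply: le_lt_trans; rewrite cell_le ltW ?rgt_lt1.
move=> uy.
move: uy; rewrite -(cellK j y) cell_lt => /IH[N HN].
by exists N => i w /HN; rewrite cell_lt.
Qed.

End Plateaus.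

(** * The sets coding subsets of [nat] *)

Section Cantorval.
Context {R : realType} (A : nat -> bool).
Implicit Types (u v w : seq nat) (i j k m n : nat) (x y p q z : R).

(** The empty word counts as whole, so that [start [::]] is 0 and the unbounded left gap is followed
    by an interval. *)
Definition whole u : bool :=
  if u is m :: w then (size w <= m.+1)%N && ((w != [::]) || ~~ A m) else true.

Definition start u : R := if whole u then lft u else (lft u + rgt u) / 2.

(* What is left of the plateau of [u] is [start u, rgt u]. *)
Definition cantorval : set R :=
  [set x | 0 <= x <= 1 /\ forall u, ~~ (lft u < x < start u)].

Lemma lft_start u : lft u <= start u.
Proof. by rewrite /start; have := lft_rgt (R := R) u; case: ifP; lra. Qed.

Lemma start_rgt u : start u < rgt u.
Proof. by rewrite /start; have := lft_rgt (R := R) u; case: ifP; lra. Qed.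

Lemma lft_lt_start u : ~~ whole u -> lft u < start u.
Proof.
by rewrite /start => /negbTE->; have := lft_rgt (R := R) u; lra.
Qed.

Lemma segment_cantorval u x : start u <= x <= rgt u -> cantorval x.
Proof.
have := lft_start u; have := start_rgt u; have := lft_ge0 (R := R) u.
have := rgt_lt1 (R := R) u => ? ? ? ? xu; split; first lra.
move=> v; apply/negP => xv; have := start_rgt v => ?.
have uv : u = v by apply: (@plateau_meet R _ _ x); lra.
by move: xu; rewrite uv; lra.
Qed.

Lemma rgt_cantorval u : cantorval (rgt u).
Proof. by apply: (@segment_cantorval u); have := start_rgt u; lra. Qed.

Lemma start_cantorval u : cantorval (start u).
Proof. by apply: (@segment_cantorval u); have := start_rgt u; lra. Qed.

Lemma lft_cantorval u : cantorval (lft u).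
Proof.
have := lft_ge0 (R := R) u; have := lft_rgt (R := R) u.
have := rgt_lt1 (R := R) u => ? ? ?; split; first lra.
move=> v; apply/negP => uv; have := start_rgt v => ?.
have vu : u = v by apply: (@plateau_meet R _ _ (lft u)); lra.
by move: uv; rewrite vu; lra.
Qed.

Lemma one_cantorval : cantorval 1.
Proof.
split; first lra.
by move=> u; have := start_rgt u; have := rgt_lt1 (R := R) u; lra.
Qed.

Lemma gaps_right_of u y : rgt u < y -> exists t : nat -> seq nat,
  injective t /\
  forall k, [/\ ~~ whole (t k), rgt u < lft (t k) :> R & rgt (t k) < y].
Proof.
move=> /subtree_close[N HN].
(* The first letter of this word is [head N u]; the zeros make the tail too long for the word to be
   whole, and their number depends injectively on [k]. *)
exists (fun k => u ++ N :: nseq ((head N u).+2 + k) 0%N); split.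
  move=> k l /(congr1 size); rewrite !size_cat/= !size_nseq; lia.
move=> k; split; [|exact: rgt_cat_lft|exact: HN].
case: u {HN} => [|i u]/=; first by rewrite size_nseq; lia.
by rewrite size_cat/= size_nseq; lia.
Qed.

(** Any plateau meeting []max 0 x, z[] ends inside it by the hypothesis on [z], which holds for
    [z = 1] and [z = lft v]. *)
Lemma plateau_left_of x z : 0 < z <= 1 ->
  (forall u, lft u < z -> rgt u < z) -> x < z -> exists u, x < rgt u < z.
Proof.
move=> z01 zP xz; have [||| u [uz pu]] := @plateau_dense R (Num.max 0 x) z.
- by rewrite le_max lexx.
- by rewrite gt_max; lra.
- lra.
by exists u; move: pu; rewrite gt_max (zP u)// => /andP[_ ->].
Qed.

Lemma lft_limit u v : lft u < lft v :> R -> rgt u < lft v :> R.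
Proof.
move=> uv; have /(@plateau_disjoint R)[//|] : u != v.
  by apply: contraTneq uv => ->; rewrite ltxx.
by have := lft_rgt (R := R) v; lra.
Qed.

(** Some plateau meets []x, y[]. If it ends there, gaps follow its right end closely; otherwise it
    reaches [y], and either [start u <= x] or a gap lies between [x] and [start u]. *)
Lemma separation x y : cantorval x -> cantorval y -> x < y ->
  (exists u, start u <= x /\ y <= rgt u) \/
  (exists2 g, x < g < y & ~ cantorval g).
Proof.
move=> [x01 Xx] [y01 Xy] xy.
have gapR u : x < rgt u < y -> exists2 g, x < g < y & ~ cantorval g.
  move=> /andP[xu /gaps_right_of[t [_ /(_ 0%N)[]]]].
  set v := t 0%N => /lft_lt_start lv uv vy; have := start_rgt v => ?.
  exists ((lft v + start v) / 2); first lra.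
  by case=> _ /(_ v); lra.
have [||| u [uy xu]] := @plateau_dense R x y; try lra.
have [yu|yu] := ltP (rgt u) y; first by right; apply: (gapR u); lra.
have [ux|ux] := leP (start u) x; first by left; exists u.
right; have [wu|wu] := boolP (whole u); last first.
  have lu := lft_lt_start wu; exists ((lft u + start u) / 2).
    by have := Xx u; have := Xy u; lra.
  by case=> _ /(_ u); lra.
have us : start u = lft u by rewrite /start wu.
have [||| v [vu xv]] := @plateau_dense R x (lft u); try lra.
by apply: (gapR v); have := lft_limit vu; lra.
Qed.

Lemma connected_cantorval (B : set R) x y : connected B -> B `<=` cantorval ->
  B x -> B y -> x < y -> exists u, start u <= x /\ y <= rgt u.
Proof.
move=> /connected_intervalP itvB BX Bx By xy.
have [//|[g /andP[xg gy] []]] := separation (BX _ Bx) (BX _ By) xy.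
by apply: BX; apply: (itvB _ _ Bx By); rewrite !ltW.
Qed.

End Cantorval.

(** * Gaps and components *)

(** Connected sets of reals are order-convex, so a missing point between [x] and [y] keeps [y] out
    of the component of [x]. *)
Lemma connected_component_interval (R : realType) (C B : set R) x :
  B x -> B `<=` C -> is_interval B ->
  (forall y, C y -> ~ B y -> exists2 g, x <= g <= y \/ y <= g <= x & ~ C g) ->
  connected_component C x = B.
Proof.
move=> Bx BC itvB sepB; apply/seteqP; split; last first.
  by apply: connected_component_max => //; exact/connected_intervalP.
move=> y Cxy; apply: contrapT => NBy.
have [g xyg] := sepB y (connected_component_sub Cxy) NBy; apply.
have /connected_intervalP itvC := component_connected (A := C) (x := x).
have Cxx : connected_component C x x by exact/connected_component_refl/BC.
apply: (@connected_component_sub _ C x).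
by case: xyg => [/(itvC _ _ Cxx Cxy)|/(itvC _ _ Cxy Cxx)].
Qed.

Section LCantorvalness.
Context {R : realType} (A : nat -> bool).
Implicit Types (u v w : seq nat) (i j k m n : nat) (x y p q z : R).

Local Notation X := (@cantorval R A).
Local Notation start := (@start R A).

Lemma component_start u :
  connected_component X (start u) = [set` `[start u, rgt u]].
Proof.
have su := @start_rgt R A u.
apply: connected_component_interval.
- by rewrite /= in_itv/= lexx ltW.
- by move=> x; rewrite /= in_itv; exact: segment_cantorval.
- exact: interval_is_interval.
move=> y Xy; rewrite /= in_itv/= => yu.
have [ys|sy] := ltP y (start u).
  have [[v [vy uv]]|[g]] := separation Xy (start_cantorval A u) ys; last first.
    by exists g => //; right; lra.
  have vu : v = u.
    apply: (@plateau_meet R _ _ (start u)).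
      by have := @lft_start R A v; have := @lft_start R A u; lra.
    by have := @lft_start R A u; lra.
  by move: ys; rewrite -vu; lra.
have uy : rgt u < y by rewrite ltNge; apply/negP => ?; apply: yu; rewrite sy.
have [|[v [vy uv]]|[g]] := separation (start_cantorval A u) Xy; first lra.
  have vu : v = u.
    apply: (@plateau_meet R _ _ (start u)).
      by have := @lft_start R A v; have := @lft_start R A u; lra.
    by have := @lft_start R A u; lra.
  by move: uy; rewrite -vu; lra.
by exists g => //; left; lra.
Qed.

Lemma nontrivial_component_start u :
  nontrivial_component X [set` `[start u, rgt u]].
Proof.
have su := @start_rgt R A u; split.
  by exists (start u); [exact: start_cantorval|exact: component_start].
exists (start u), (rgt u); split; rewrite /= ?in_itv/=; try lra.
Qed.

Lemma notin_cantorval x : ~ X x ->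
  [\/ x < 0, 1 < x | exists2 u, ~~ whole A u & lft u < x < start u].
Proof.
move=> NXx; have [x0|x0] := ltP x 0; first exact: Or31.
have [x1|x1] := ltP 1 x; first exact: Or32.
apply: Or33; apply: contrapT => H; apply: NXx; split; first by rewrite x0.
move=> u; apply/negP => xu; apply: H; exists u => //.
by apply/negP => wu; move: xu; rewrite /start wu; lra.
Qed.

Lemma component_gap u x : lft u < x < start u ->
  connected_component (~` X) x = [set` `]lft u, start u[].
Proof.
move=> xu; apply: connected_component_interval.
- by rewrite /= in_itv.
- by move=> y /=; rewrite in_itv/= => yu [_ /(_ u)]; rewrite yu.
- exact: interval_is_interval.
move=> y _; rewrite /= in_itv/= => yu.
have [yl|ly] := leP y (lft u).
  by exists (lft u); [right; lra|apply; exact: lft_cantorval].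
have [sy|] := leP (start u) y; last by move=> ?; case: yu; rewrite ly.
by exists (start u); [left; lra|apply; exact: start_cantorval].
Qed.

Lemma gapP (G : set R) : gap X G ->
  [\/ G = [set` `]-oo, 0[], G = [set` `]1, +oo[] |
    exists2 u, ~~ whole A u & G = [set` `]lft u, start u[]].
Proof.
move=> [x /notin_cantorval + <-].
case=> [x0|x1|[u wu xu]].
- apply: Or31; apply: connected_component_interval.
  + by rewrite /= in_itv.
  + by move=> y /=; rewrite in_itv/= => y0 [] /andP[]; lra.
  + exact: interval_is_interval.
  move=> y _; rewrite /= in_itv/= => /negP; rewrite -leNgt => y0.
  exists 0; first by left; lra.
  by apply; exact: (lft_cantorval A [::]).
- apply: Or32; apply: connected_component_interval.
  + by rewrite /= in_itv/= x1.
  + by move=> y /=; rewrite in_itv/= => y0 [] /andP[]; lra.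
  + exact: interval_is_interval.
  move=> y _; rewrite /= in_itv/= andbT => /negP; rewrite -leNgt => y0.
  exists 1; first by right; lra.
  by apply; exact: one_cantorval.
- by apply: Or33; exists u => //; exact: component_gap.
Qed.

Lemma gap_start u : ~~ whole A u -> gap X [set` `]lft u, start u[].
Proof.
move=> /(@lft_lt_start R) lu; exists ((lft u + start u) / 2).
  by case=> _ /(_ u); lra.
by rewrite (component_gap (u := u))//; lra.
Qed.

(** Some plateau ends in []z - e, z[]; the non-whole words of [gaps_right_of] follow it, still left
    of [z], and each contributes a gap and an interval. *)
Lemma infinite_left_of z e : 0 < z <= 1 ->
  (forall u, lft u < z -> rgt u < z) -> 0 < e ->
  infinite_set [set H | gap X H /\ H `<=` [set` `]z - e, z[]] /\
  infinite_set [set I | nontrivial_component X I /\ I `<=` [set` `]z - e, z[]].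
Proof.
move=> z01 zP e0.
have [|u /andP[zu uz]] := plateau_left_of z01 zP (x := z - e); first lra.
have [t [tinj tP]] := gaps_right_of A uz.
have lftsup v w : ~~ whole A v ->
   [set` `]lft v, start v[] = [set` `]lft w, start w[] :> set R -> v = w.
  move=> /(@lft_lt_start R) lv.
  move=> /seteqP[/(_ ((lft v + start v) / 2)) + _].
  rewrite /= !in_itv/= => /(_ ltac:(lra)) ?.
  have := @start_rgt R A v; have := @start_rgt R A w => ? ?.
  by apply: (@plateau_meet R _ _ ((lft v + start v) / 2)); lra.
have segsup v w :
    [set` `[start v, rgt v]] = [set` `[start w, rgt w]] :> set R -> v = w.
  move=> /seteqP[/(_ (rgt v)) + _].
  have := @start_rgt R A v; have := @start_rgt R A w => ? ?.
  rewrite /= !in_itv/= => /(_ ltac:(lra)) ?.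
  have := @lft_start R A v; have := @lft_start R A w => ? ?.
  by apply: (@plateau_meet R _ _ (rgt v)); lra.
have inf (f : seq nat -> set R) P : (forall k, P (f (t k))) ->
    (forall k l, f (t k) = f (t l) -> k = l) -> infinite_set [set B | P B].
  move=> fP finj; apply: (@sub_infinite_set _ (range (f \o t))).
    by move=> _ [k _ <-]; exact: fP.
  apply/infiniteP; have : range (f \o t) #= [set: nat].
    by apply: inj_card_eq => k l _ _; exact: finj.
  by rewrite card_eq_le => /andP[].
split.
- apply: (inf (fun v => [set` `]lft v, start v[])) => [k|k l]; last first.
    by have [wk _ _] := tP k; move=> /(lftsup _ _ wk)/tinj.
  have [wk uk kz] := tP k; split; first exact: gap_start.
  move=> x; rewrite /= !in_itv/=; have := @start_rgt R A (t k); lra.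
- apply: (inf (fun v => [set` `[start v, rgt v]])) => [k|k l]; last first.
    by move=> /segsup/tinj.
  have [wk uk kz] := tP k; split; first exact: nontrivial_component_start.
  move=> x; rewrite /= !in_itv/=; have := @lft_start R A (t k); lra.
Qed.

Lemma cantorval_compact : compact X.
Proof.
have -> : X = [set` `[0, 1]] `&` \bigcap_u ~` [set` `]lft u, start u[].
  apply/seteqP; split => x; rewrite /= in_itv/= => -[x01 xP]; split => //.
    by move=> u _ /=; rewrite in_itv/=; exact/negP.
  by move=> u; have := xP u I; rewrite /= in_itv/= => /negP.
apply: (subclosed_compact _ (@segment_compact R 0 1)) => //.
apply: closedI; first exact: interval_closed.
by apply: closed_bigI => u _; exact/open_closedC/itv_open.
Qed.

Lemma right_endpoint_itv (a : itv_bound R) b r s :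
  (a < BSide b r)%O -> right_endpoint [set` Interval a (BSide b r)] s -> s = r.
Proof.
move=> ar [ub_s le_s]; have ? := has_sup_half ar.
rewrite -(sup_itv ar); apply/eqP; rewrite eq_le le_s/=; last first.
  exact: sup_upper_bound.
by apply: ge_sup => //; exact: (has_sup_half ar).1.
Qed.

Lemma left_endpoint_itv (a : itv_bound R) b r s :
  (BSide b r < a)%O -> left_endpoint [set` Interval (BSide b r) a] s -> s = r.
Proof.
move=> ra [lb_s ge_s]; have [? _] := has_inf_half ra.
rewrite -(inf_itv ra); apply/eqP; rewrite eq_le lb_le_inf//= ge_s//.
apply: ge_inf; exact: (has_inf_half ra).2.
Qed.

Lemma cantorval_LCantorval : is_LCantorval X.
Proof.
split; [by exists 1; exact: one_cantorval|exact: cantorval_compact| |].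
- move=> G s /gapP gapG supG.
  have [u ->] : exists u, s = start u.
    case: gapG supG => [->|->|[u wu ->]].
    + by move=> /right_endpoint_itv->//; exists [::].
    + case=> /(_ (Num.max 2 (s + 1))); rewrite /= in_itv/= andbT.
      by rewrite lt_max ltr1n/= ge_max => /(_ isT); lra.
    + move=> /right_endpoint_itv->; first by exists u.
      by rewrite bnd_simp lft_lt_start.
  exists [set` `[start u, rgt u]].
  split; first exact: nontrivial_component_start.
  split; first by move=> x /=; rewrite in_itv/= => /andP[].
  by move=> x; apply; rewrite /= in_itv/= lexx ltW// start_rgt.
- move=> G s /gapP gapG infG e e0.
  (* The finite left endpoints of gaps are 1 and [lft u] for [u] not whole, hence nonempty. *)
  suff [s01 sP] : 0 < s <= 1 /\ forall u, lft u < s -> rgt u < s.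
    exact: infinite_left_of.
  case: gapG infG => [->|->|[u wu ->]].
  + case=> /(_ (Num.min (-1) (s - 1))); rewrite /= in_itv/=.
    by rewrite gt_min ltrN10/= le_min => /(_ isT); lra.
  + move=> /left_endpoint_itv->//; split; first lra.
    by move=> u _; exact: rgt_lt1.
  + move=> /left_endpoint_itv->; last by rewrite bnd_simp lft_lt_start.
    split; last by move=> v; exact: lft_limit.
    case: u wu => // i u _; have := @half_lt_lft R i u.
    by have := @lft_rgt R (i :: u); have := @rgt_lt1 R (i :: u); lra.
Qed.

End LCantorvalness.

(** * A homeomorphism invariant *)

Section Invariant.
Implicit Types T U : topologicalType.

Definition component_boundary T : set T :=
  [set x | ~ nbhs x (connected_component setT x)].

(** In [cantorval A] such a point is an end of a whole plateau of a nonempty word; every other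
    component has at most one boundary point. *)
Definition two_sided T : set T :=
  [set x | component_boundary x /\
    exists y, [/\ y != x, connected_component setT x y & component_boundary y]].

(** Cantor-Bendixson derivatives, but with limit points taken in all of [T]: a point of
    [derived n.+1] may fail to be two-sided, which [mark] exploits. *)
Definition derived T n : set T := iter n (@limit_point T) (@two_sided T).

(** In [cantorval A] the only possible witness is the right end of [[:: n]], and it is one exactly
    when that plateau is not whole. *)
Definition mark T n : Prop :=
  exists x : T, [/\ derived n.+1 x, ~ derived n.+2 x & ~ two_sided x].

Lemma continuous_component T U (f : T -> U) x y : continuous f ->
  connected_component setT x y -> connected_component setT (f x) (f y).
Proof.
move=> cf xy.
apply: (@connected_component_max _ _ (f @` connected_component setT x)) => //.
- by exists x => //; exact: connected_component_refl.
- apply: connected_continuous_connected; first exact: component_connected.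
  exact: continuous_subspaceT.
Qed.

Section Homeomorphism.
Context T U (f : T -> U) (g : U -> T).
Hypotheses (cf : continuous f) (cg : continuous g).
Hypothesis (fK : cancel f g).

Lemma homeo_component_boundary x :
  component_boundary x -> component_boundary (f x).
Proof.
move=> bx; apply: contra_not bx => /cf fx.
apply: (@filterS _ _ _ (f @^-1` connected_component setT (f x))) => // y.
by move=> /(continuous_component cg); rewrite !fK.
Qed.

Lemma homeo_two_sided x : two_sided x -> two_sided (f x).
Proof.
move=> [bx [y [yx xy by_]]]; split; first exact: homeo_component_boundary.
exists (f y); split; first by rewrite (inj_eq (can_inj fK)).
- exact: continuous_component.
- exact: homeo_component_boundary.
Qed.

Lemma homeo_derived n x : derived n x -> derived n (f x).
Proof.
elim: n x => [|n IH] x; first exact: homeo_two_sided.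
move=> /= xn V /cf/xn[y [yx yn Vy]]; exists (f y); split => //.
- by rewrite (inj_eq (can_inj fK)).
- exact: IH.
Qed.
End Homeomorphism.

Lemma homeo_mark T U n : homeomorphic T U -> mark T n -> mark U n.
Proof.
move=> [f [g [cf cg fK gK]]] [x [xn xSn xt]]; exists (f x); split.
- exact: (homeo_derived cf cg fK).
- by apply: contra_not xSn => /(homeo_derived cg cf gK); rewrite fK.
- by apply: contra_not xt => /(homeo_two_sided cg cf gK); rewrite fK.
Qed.

End Invariant.

(** * Limit points of plateau ends *)

Lemma limit_pointU (T : topologicalType) (E F : set T) x :
  limit_point (E `|` F) x -> limit_point E x \/ limit_point F x.
Proof.
move=> EFx; apply: contrapT => /not_orP[].
rewrite !not_limit_pointE => -[U xU EU] [V xV FV].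
have [y [yx [Ey|Fy] [Uy Vy]]] := EFx _ (filterI xU xV).
- by move/eqP: yx; apply; exact: EU.
- by move/eqP: yx; apply; exact: FV.
Qed.

Lemma limit_point_bigcup (T : topologicalType) (E : nat -> set T) N x :
  limit_point (\bigcup_(i < N) E i) x -> exists i, limit_point (E i) x.
Proof.
elim: N => [|N IH].
  by rewrite bigcup0// => /(_ setT filterT)[y []].
rewrite bigcup_mkord big_ord_recr -bigcup_mkord /=.
by move=> /limit_pointU[/IH|]//; exists N.
Qed.

Section Ends.
Context {R : realType}.
Implicit Types (P : set (seq nat)) (u v w : seq nat) (i j n : nat) (x y z : R).

Definition ends P : set R :=
  [set z | exists2 u, P u & z = lft u \/ z = rgt u].

Lemma limit_point_cell E i y :
  limit_point (cell i @` E) (cell i y) -> limit_point E y.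
Proof.
move=> lim U yU; pose r x : R := (x - 2^-1) / cell_scale i - 1.
have cellr : cancel (cell i) r.
  move=> x; rewrite /r /cell; field.
  by rewrite gt_eqF ?cell_scale_gt0.
have rU : nbhs (cell i y) (r @^-1` U).
  have : {for cell i y, continuous r}.
    apply: cvgB; last exact: cvg_cst.
    by apply: cvgM; [apply: cvgB; [exact: cvg_id|]|]; exact: cvg_cst.
  by apply; rewrite cellr.
have [z [zy [x Ex xz] Uz]] := lim _ rU; move: zy Uz; rewrite -xz.
by rewrite (inj_eq (can_inj cellr)) /= cellr => xy Ux; exists x.
Qed.

(** Cells accumulate only at 1/2. Near [y > 1/2] only finitely many occur, so the ends in a single
    cell already accumulate at [y], and its map can be undone. *)
Lemma limit_point_ends P y : limit_point (ends P) y ->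
  (y = 2^-1 /\ exists i w, P (i :: w)) \/
  (exists i x, y = cell i x /\ limit_point (ends [set w | P (i :: w)]) x).
Proof.
move=> lim.
(* Without the left end 0 of the root, all ends are at least 1/2. *)
have lim0 := limit_point_setD (finite_set1 0) lim.
have yhalf : 2^-1 <= y.
  rewrite leNgt; apply/negP => y2.
  have [|z [_ [[u Pu uz] z0]]] := lim0 [set` `]-oo, 2^-1[].
    by apply: open_nbhs_nbhs; split; [exact: lray_open|rewrite /= in_itv].
  rewrite /= in_itv/=; case: u Pu uz => [_|i w _].
    by rewrite /lft /rgt /=; case=> // ->; rewrite ltxx.
  have := @half_lt_lft R i w; have := @lft_rgt R (i :: w) => ? ?.
  by case=> ->; lra.
have [y2|y2] := ltP 2^-1 y; last first.
  left; split; first lra.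
  (* The ends of the empty word are the removed 0 and [y] itself, so another end comes from a
     nonempty word. *)
  have [z [zy [[[|i w] Pu uz] z0] _]] := lim0 setT filterT; last by exists i, w.
  case: uz => // ; rewrite /rgt /= => z2.
  by move/eqP: zy; case; lra.
right.
have [|N HN] := @cell_close R 1 ((2^-1 + y) / 2) ler01; first lra.
suff /limit_point_bigcup[i] :
    limit_point (\bigcup_(i < N) (cell i @` ends [set w | P (i :: w)])) y.
  rewrite -{1}(cellK i y) => /limit_point_cell lim_i.
  by exists i, ((y - 2^-1) / cell_scale i - 1); rewrite cellK.
move=> U yU.
have yV : nbhs y [set` `](2^-1 + y) / 2, +oo[].
  apply: open_nbhs_nbhs; split; first exact: rray_open.
  by rewrite /= in_itv/= andbT; lra.
have [z [zy [[|i w] Pu uz] [Uz]]] := lim _ (filterI yU yV).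
  by rewrite /= in_itv/= andbT; case: uz => ->; rewrite /lft /rgt/=; lra.
rewrite /= in_itv/= andbT => yz; exists z; split => //.
have zi : z <= cell i 1.
  have := @lft_rgt R w; have := @rgt_lt1 R w => ? ?.
  by case: uz => ->; rewrite /= cell_le; lra.
exists i; first by rewrite /= ltnNge; apply/negP => /HN; lra.
by case: uz => ->; [exists (lft w)|exists (rgt w)] => //;
  exists w => //; [left|right].
Qed.

(** Each use of [limit_point_ends] strips a letter and lowers the bound, so the descent stops at 1/2
    inside nested cells, the right end of a proper prefix of a word of [P]. *)
Lemma limit_point_ends_bounded d P y : (forall u, P u -> (size u < d)%N) ->
  limit_point (ends P) y -> exists v i w, y = rgt v /\ P (v ++ i :: w).
Proof.
elim: d P y => [|d IH] P y Pd.
  by move=> /(_ setT filterT)[z [_ [u /Pd]]].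
move=> /limit_point_ends[[-> [i [w Piw]]]|[i [x [-> lim]]]].
  by exists [::], i, w.
have [|v [k [w [-> Pv]]]] := IH _ _ _ lim; first by move=> u /Pd.
by exists (i :: v), k, w.
Qed.

(** For [j = 0] this is the length condition of [whole] without the exception made by [A]. The root
    has every rank. *)
Definition rank_ge j u : bool :=
  if u is m :: w then (j + size w <= m.+1)%N else true.

(** Inside cell [i] the letter [i] bounds the lengths of the words, so limits are right ends of
    proper prefixes, and losing a letter raises the rank. *)
Lemma limit_point_rank j y : limit_point (ends (rank_ge j)) y ->
  exists2 u, rank_ge j.+1 u & y = rgt u.
Proof.
move=> /limit_point_ends[[-> _]|[i [x [-> lim]]]]; first by exists [::].
have [|v [k [w [-> Pv]]]] := limit_point_ends_bounded (d := i.+2) _ lim.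
  by move=> u /=; lia.
exists (i :: v) => //=; move: Pv; rewrite /= size_cat/=; lia.
Qed.

End Ends.

(** * Computing the invariant *)

Lemma set_val_continuous (T : topologicalType) (B : set T) :
  continuous (set_val : set_type B -> T).
Proof. exact: initial_continuous. Qed.

Lemma nbhs_set_type (R : realType) (B : set R) (x : set_type B)
    (V : set (set_type B)) :
  nbhs x V <->
  exists2 e : R, 0 < e & forall y : set_type B, `|val y - val x| < e -> V y.
Proof.
split=> [|[e e0 eV]].
  rewrite nbhsE => -[_ [[W oW <-] Wx] WV].
  have /nbhs_ballP[e /= e0 eW] : nbhs (val x) W by exact: open_nbhs_nbhs.
  by exists e => // y xy; apply/WV/eW; rewrite /ball/= distrC.
have := set_val_continuous (x := x) (nbhsx_ballx (val x) e e0).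
apply: (@filterS _ (nbhs x) _ (set_val @^-1` ball (val x) e)) => y.
by rewrite /ball/= distrC; exact: eV.
Qed.

Section Marks.
Context {R : realType} (A : nat -> bool).
Implicit Types (u v w : seq nat) (i j k m n : nat).

Local Notation X := (@cantorval R A).
Local Notation start := (@start R A).
Local Notation whole := (@whole A).

Implicit Types x y : set_type X.

Lemma set_val_cantorval x : X (val x).
Proof. exact: set_valP. Qed.

(** * Components and two-sided points of the subspace *)

Lemma component_order x y : connected_component setT x y ->
  val x < val y -> exists u, start u <= val x /\ val y <= rgt u.
Proof.
move=> xy.
apply: (@connected_cantorval R A (val @` connected_component setT x)).
- apply: connected_continuous_connected; first exact: component_connected.
  exact/continuous_subspaceT/set_val_continuous.
- by move=> _ [z _ <-]; exact: set_val_cantorval.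
- by exists x => //; exact: connected_component_refl.
- by exists y.
Qed.

(** Clamping retracts the line onto the segment, which lies in [X]; the range of this map into the
    subspace is connected and contains both points. *)
Lemma component_segment u x y :
  start u <= val x <= rgt u -> start u <= val y <= rgt u ->
  connected_component setT x y.
Proof.
move=> xu yu; have su := @start_rgt R A u.
pose clamp (t : R) : R := Num.max (start u) (Num.min (rgt u) t).
have clampX t : X (clamp t).
  apply: (@segment_cantorval R A u).
  by rewrite /clamp le_max lexx ge_max (ltW su) ge_min lexx.
have clampK t : start u <= t <= rgt u -> clamp t = t.
  by move=> /andP[ut tu]; rewrite /clamp (min_idPr tu) (max_idPr ut).
pose f (t : R) : set_type X := exist _ (clamp t) (mem_set (clampX t)).
have fK z : start u <= val z <= rgt u -> f (val z) = z.
  by move=> zu; apply: val_inj; exact: clampK.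
apply: (@connected_component_max _ _ (range f)).
- by exists (val x) => //; exact: fK.
- by [].
- apply: connected_continuous_connected.
    exact/connected_intervalP.
  apply: continuous_subspaceT; apply: continuous_comp_initial => t.
  apply: (@continuous_max R R (cst (start u)) (fun t => Num.min (rgt u) t) t).
    exact: cvg_cst.
  apply: (@continuous_min R R (cst (rgt u)) id t); first exact: cvg_cst.
  exact: cvg_id.
- by exists (val y) => //; exact: fK.
Qed.

(** The segment is a neighbourhood of its inner points, and also of [start u] when a gap precedes it
    ([u] not whole) or nothing does ([u] empty). *)
Lemma component_boundary_segment u x : component_boundary x ->
  start u <= val x <= rgt u ->
  val x = rgt u \/ [/\ val x = start u, whole u & u != [::]].
Proof.
move=> bx ux; apply: contrapT => /not_orP[xr xs]; apply: bx.
have xu : val x < rgt u by rewrite lt_neqAle; have /eqP -> := xr; case/andP: ux.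
suff [e e0 He] : exists2 e : R, 0 < e &
    forall t, X t -> `|t - val x| < e -> start u <= t.
  apply/nbhs_set_type; exists (Num.min e (rgt u - val x)).
    by rewrite lt_min e0/= subr_gt0.
  move=> y; rewrite lt_min => /andP[/(He _ (set_val_cantorval y)) uy].
  by rewrite ltr_distl => yx; apply: (@component_segment u) => //; lra.
have [sx|xs'] := ltP (start u) (val x).
  by exists (val x - start u) => [|t _]; rewrite ?ltr_distl; lra.
have {xs'} xsu : val x = start u by lra.
have [wu|/(@lft_lt_start R) lu] := boolP (whole u); last first.
  by exists (start u - lft u) => [|t [_ /(_ u)]]; rewrite ?ltr_distl; lra.
have [u0|u0] := eqVneq u [::]; last by case: xs.
by exists 1 => // t [/andP[t0 _] _] _; rewrite u0.
Qed.

(** Of two distinct boundary points in one segment, at most one is [rgt u]; the other is [start u],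
    which forces [u] to be whole and nonempty. *)
Lemma two_sided_sub x : two_sided x ->
  exists u, [/\ whole u, u != [::] & val x = lft u \/ val x = rgt u].
Proof.
move=> [bx [y [yx xy by_]]].
have [u [ux uy]] : exists u,
    start u <= val x <= rgt u /\ start u <= val y <= rgt u.
  have yx' : val y != val x by rewrite (inj_eq val_inj).
  have [xly|ylx|xey] := ltgtP (val x) (val y).
  - by have [u []] := component_order xy xly; exists u; lra.
  - have [u []] := component_order (connected_component_sym xy) ylx.
    by exists u; lra.
  - by move: yx'; rewrite xey eqxx.
exists u.
have su : whole u -> start u = lft u by rewrite /start => ->.
have [xr|[xs wu u0]] := component_boundary_segment bx ux; last first.
  by split => //; left; rewrite -su.
have [yr|[_ wu u0]] := component_boundary_segment by_ uy; last by split; auto.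
by case/eqP: yx; apply: val_inj; rewrite xr.
Qed.

(** Other right ends accumulate at [rgt u] from the right, and none lies in its component: a segment
    containing both would be that of [u]. *)
Lemma component_boundary_rgt u x : val x = rgt u -> component_boundary x.
Proof.
move=> xu /nbhs_set_type[e e0 He].
have [|t [_ /(_ 0%N)[_]]] := @gaps_right_of R A u (rgt u + e); first lra.
set v := t 0%N => uv ve; have lv := @lft_rgt R v.
pose y : set_type X := exist _ (rgt v) (mem_set (rgt_cantorval A v)).
have /component_order : connected_component setT x y.
  by apply: He; rewrite xu /= ltr_distl; lra.
rewrite xu /= => /(_ ltac:(lra))[w [wu vw]].
suff : w = u by move=> wu'; move: vw; rewrite wu'; lra.
have := @lft_start R A w; have := @lft_rgt R u => ? ?.
by apply: (@plateau_meet R _ _ (rgt u)); lra.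
Qed.

Lemma component_boundary_lft u x : u != [::] -> val x = lft u ->
  component_boundary x.
Proof.
move=> u0 xu /nbhs_set_type[e e0 He].
have lu0 : 0 < (lft u : R) <= 1.
  have := @lft_rgt R u; have := @rgt_lt1 R u.
  by case: (u) u0 => // i v _; have := @half_lt_lft R i v; lra.
have [|v /andP[ev vu]] :=
  @plateau_left_of R (lft u - e) _ lu0 (@lft_limit R ^~ u).
  lra.
pose y : set_type X := exist _ (rgt v) (mem_set (rgt_cantorval A v)).
have /connected_component_sym/component_order : connected_component setT x y.
  by apply: He; rewrite xu /= ltr_distl; lra.
rewrite xu /= => /(_ vu)[w [wv uw]].
suff : w = v by move=> wv'; move: uw; rewrite wv'; lra.
have := @lft_start R A w; have := @lft_rgt R v => ? ?.
by apply: (@plateau_meet R _ _ (rgt v)); lra.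
Qed.

Lemma two_sided_rgt u x : whole u -> u != [::] -> val x = rgt u -> two_sided x.
Proof.
move=> wu u0 xu; split; first exact: component_boundary_rgt xu.
have lu := @lft_rgt R u.
pose y : set_type X := exist _ (lft u) (mem_set (lft_cantorval A u)).
exists y; split; last exact: component_boundary_lft u0 _.
  by rewrite -(inj_eq val_inj) /= xu lt_eqF.
apply: (@component_segment u); rewrite ?xu /=.
  by have := @start_rgt R A u; lra.
by rewrite /start wu; lra.
Qed.

(** The right ends of the words [m :: w ++ [:: N]], one letter longer and of rank one less, converge
    to [rgt (m :: w)]. At [j = 0] the side condition excludes [[:: m]], whose wholeness depends on
    [A]. *)
Lemma derived_rgt j m w x :
  (j + size w <= m.+1)%N -> (0 < j)%N || (w != [::]) ->
  val x = rgt (m :: w) -> derived j x.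
Proof.
elim: j w x => [|j IH] w x.
  by rewrite add0n => wm w0 xmw; apply: two_sided_rgt xmw => //=;
    rewrite wm (w0 : w != [::]).
move=> wm _ xmw V /nbhs_set_type[e e0 eV].
have [|N /(_ N [::] (leqnn N))] := @subtree_close R (m :: w) (val x + e).
  by rewrite xmw; lra.
have := @rgt_cat_lft R (m :: w) N [::].
have := @lft_rgt R ((m :: w) ++ [:: N]).
set v := _ ++ _ => ? ? ?.
pose y : set_type X := exist _ (rgt v) (mem_set (rgt_cantorval A v)).
have yv : val y = rgt v by [].
exists y; split.
- by rewrite -(inj_eq val_inj) yv xmw gt_eqF//; lra.
- apply: (IH (w ++ [:: N])) => //; first by rewrite size_cat/=; lia.
  by rewrite -size_eq0 size_cat addn1 orbT.
- by apply: eV; rewrite yv xmw ltr_distl; lra.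
Qed.

(* [rgt [::]] has infinite rank, so it never contributes to [mark]. *)
Lemma derived_rgt_nil j x : val x = rgt [::] -> derived j.+1 x.
Proof.
move=> x0 V /nbhs_set_type[e e0 eV].
have [|N] := @subtree_close R [::] (val x + e); first by rewrite x0; lra.
(* A first letter at least [N] gives closeness to 1/2; at least [j], it gives the rank that
   [derived_rgt] asks for. *)
move=> /(_ (maxn N j) [:: 0%N] (leq_maxl _ _)).
have := @rgt_cat_lft R [::] (maxn N j) [:: 0%N].
have := @lft_rgt R ([::] ++ [:: maxn N j; 0%N]).
set v := [::] ++ _ => ? ? ?.
pose y : set_type X := exist _ (rgt v) (mem_set (rgt_cantorval A v)).
have yv : val y = rgt v by [].
exists y; split.
- by rewrite -(inj_eq val_inj) yv x0 gt_eqF//; lra.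
- apply: (@derived_rgt _ (maxn N j) [:: 0%N]) => //=; last exact: orbT.
  by have := leq_maxr N j; lia.
- by apply: eV; rewrite yv x0 ltr_distl; lra.
Qed.

Lemma derived_sub j x : derived j x ->
  exists2 u, rank_ge j u & val x = lft u \/ val x = rgt u.
Proof.
elim: j x => [|j IH] x.
  move=> /two_sided_sub[[|m w] [wu u0 xu]] //.
  by exists (m :: w) => //; case/andP: wu.
move=> xS; have [|u uj ->] := @limit_point_rank R j (val x).
  move=> V /set_val_continuous/xS[y [yx /IH[u uj yu] Vy]].
  by exists (val y); split=> //; exists u.
by exists u => //; right.
Qed.

Lemma derivedS_sub j x : derived j.+1 x ->
  exists2 u, rank_ge j.+1 u & val x = rgt u.
Proof.
move=> xS; apply: limit_point_rank => V.
move=> /set_val_continuous/xS[y [yx /derived_sub[u uj yu] Vy]].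
by exists (val y); split=> //; exists u.
Qed.

Lemma rgt_inj u v : rgt u = rgt v :> R -> u = v.
Proof.
move=> uv; have := @lft_rgt R u; have := @lft_rgt R v => ? ?.
by apply: (@plateau_meet R _ _ (rgt u)); lra.
Qed.

Lemma markP n : mark (set_type X) n <-> A n.
Proof.
split=> [[x [xn xSn xt]]|An].
  have [[|m w] wn xmw] := derivedS_sub xn.
    by case: xSn; exact: derived_rgt_nil.
  (* A nonempty tail would make the plateau whole and [x] two-sided; after that, [m > n] would put
     [x] in [derived n.+2]. *)
  have [w0|w0] := eqVneq w [::]; last first.
    case: xt; apply: two_sided_rgt xmw => //=; rewrite w0 andbT.
    by move: wn => /=; lia.
  move: w0 wn xmw => -> nm xm; rewrite /= addn0 ltnS in nm.
  have [<-|mn] := eqVneq m n.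
    by apply/negPn/negP => Am; case: xt; apply: two_sided_rgt xm.
  by case: xSn; apply: (derived_rgt _ _ xm) => //=; lia.
pose x : set_type X := exist _ (rgt [:: n]) (mem_set (rgt_cantorval A [:: n])).
exists x; split.
- by apply: (@derived_rgt _ n [::]) => //=; rewrite addn0.
- by move=> /derivedS_sub[u + /rgt_inj xu]; rewrite -xu /= addn0 ltnn.
- move=> /two_sided_sub[u [+ _ xu]]; suff <- : [:: n] = u by rewrite /= An.
  have := @lft_rgt R [:: n]; have := @lft_rgt R u => ? ?.
  have {}xu : rgt [:: n] = lft u \/ rgt [:: n] = rgt u := xu.
  by apply: (@plateau_meet R _ _ (rgt [:: n])); case: xu => ?; lra.
Qed.

End Marks.

(* [set_type X] carries the subspace topology. *)
Theorem theorem17 (R : realType) :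
  exists F : set (set R),
    [/\ F #= [set: nat -> bool],
        (forall X : set R, F X -> is_LCantorval X)
      & (forall X Y : set R, F X -> F Y -> X <> Y ->
           ~ homeomorphic (set_type X) (set_type Y))].
Proof.
exists (range (@cantorval R)); split.
(* The marks recover [A] from the set, so [cantorval] is injective. *)
- apply: inj_card_eq => A B _ _ AB; apply/funext => n; apply/idP/idP.
  + by move=> /(@markP R); rewrite AB => /markP.
  + by move=> /(@markP R); rewrite -AB => /markP.
- by move=> _ [A _ <-]; exact: cantorval_LCantorval.
move=> _ _ [A _ <-] [B _ <-] AB homAB; apply: AB; congr (cantorval _).
have homBA :
    homeomorphic (set_type (@cantorval R B)) (set_type (@cantorval R A)).
  by have [f [g [? ? ? ?]]] := homAB; exists g, f.
apply/funext => n; apply/idP/idP => /(@markP R).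
- by move=> /(homeo_mark homAB)/markP.
- by move=> /(homeo_mark homBA)/markP.
Qed.
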